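(* Let $G$ be a group of exponent $3$ (not assumed finite). Then $G$ is an ECP-group; that is, for every subgroup $H\le G$ and every $x\in G$ one has $HH^x=H^xH$.
   Context: For a subgroup $H$ of a group $G$ and $x\in G$, $H^x=x^{-1}Hx$, and for subgroups $A,B\le G$, $AB=\{ab : a\in A,\ b\in B\}$. A subgroup $H$ of $G$ is called conjugate-permutable in $G$ if $HH^x=H^xH$ for every $x\in G$. A group is called an ECP-group if every one of its subgroups is conjugate-permutable. A group of exponent $3$ is one in which $g^3=1$ for all elements $g$. *)

(* Defs.v *)
From mathcomp Require Import all_boot.
From mathcomp Require Import boolp classical_sets.

Set Implicit Arguments.
Unset Strict Implicit.
Unset Printing Implicit Defensive.

Local Open Scope classical_set_scope.
Local Open Scope group_scope.

Section ECP.
Variable G : groupType.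
Implicit Types A B H : set G.

(* [mem H] is classical membership, so [H] ranges over arbitrary
   (not only decidable) subgroups. *)
Definition is_subgroup H : Prop := group_closed (mem H).

Definition setprod A B : set G := [set a * b | a in A & b in B].

(* Recall that [h ^ x] unfolds to [x^-1 * (h * x)]. *)
Definition conj_set H (x : G) : set G := [set h ^ x | h in H].

Definition conjugate_permutable H : Prop :=
  forall x : G, setprod H (conj_set H x) = setprod (conj_set H x) H.

End ECP.

Definition ECP_group (G : groupType) : Prop :=
  forall H : set G, is_subgroup H -> conjugate_permutable H.

(* The trivial group is allowed. *)
Definition has_exponent_3 (G : groupType) : Prop :=
  forall g : G, g ^+ 3 = 1.

(* Main.v *)
Require Import Defs.
From mathcomp Require Import all_boot.
From mathcomp Require Import boolp classical_sets.

(** Fix [b]. The conjugates of [b] commute with each other, and on the abelian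
    group they generate every [g] acts with [1 + g + g^-1 = 0], because
    [(g b)^3 = 1]. Expanding this relation for [g = a x] with the ones for
    [a] and [x] gives, additively, [x a^-1 = a x - 1 + a] on [b], that is
    [b ^ (x a^-1) = b ^ (a x) * b^-1 * b ^ a]. The first factor lies in [H^x]
    and the others in [H], whence [H H^x] is contained in [H^x H]; the
    converse inclusion follows by inversion. *)

Local Open Scope classical_set_scope.
Local Open Scope group_scope.

Section ExponentThree.
Variable G : groupType.
Hypothesis exp3 : has_exponent_3 G.
Implicit Types a b g x : G.

Lemma mulgg_exp3 g : g * g = g^-1.
Proof. by apply: (mulIg g); rewrite mulVg -[RHS](exp3 g) -mulgA. Qed.

Lemma conj_trace_exp3 b g : b ^ g^-1 * b ^ g * b = 1.
Proof.
rewrite -[RHS](exp3 (g * b)) !expgS expg0 mulg1 !conjgE invgK -!mulgA.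
by rewrite (mulgA g^-1 g^-1) mulgg_exp3 invgK.
Qed.

(** Both orders of [b ^ g * b ^ g^-1] are inverse to [b]; conjugation by [g] sends the pair [b],
    [b ^ g] to [b ^ g], [b ^ g^-1], as [g * g = g^-1]. *)
Lemma commute_conj_exp3 b g : commute b (b ^ g).
Proof.
have comm_conjV : b ^ g * b ^ g^-1 = b ^ g^-1 * b ^ g.
  apply: (mulIg b); rewrite conj_trace_exp3.
  by have := conj_trace_exp3 b g^-1; rewrite invgK.
by apply: (@conjg_inj _ g); rewrite (conjMg b) (conjMg _ b) -conjgM mulgg_exp3.
Qed.

Lemma conjV_exp3 b g : b ^ g^-1 = (b ^ g * b)^-1.
Proof.
apply: (mulIg (b ^ g * b)).
by rewrite mulVg mulgA conj_trace_exp3.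
Qed.

Lemma conj_mulV_exp3 a b x : b ^ (x * a^-1) = b ^ (a * x) * (b^-1 * b ^ a).
Proof.
(* Compute [b ^ (a * x)^-1] at once and as [(b ^ x^-1) ^ a^-1]. *)
have conjVax : (b ^ (a * x) * b)^-1 = b ^ a * b * (b ^ (x * a) * b ^ x).
  rewrite -conjV_exp3 (invgM a) (conjgM b x^-1) (conjV_exp3 b) conjVg.
  rewrite (conjMg (b ^ x)) (conjV_exp3 b a) (conjV_exp3 (b ^ x) a).
  by rewrite -(conjgM b x) -invgM invgK.
rewrite (conjgM b x) conjV_exp3 -(conjgM b).
rewrite -(mulKg (b ^ a * b) (_ * b ^ x)) -conjVax -invgM invgK.
rewrite -mulgA -(commute_conj_exp3 b a) (mulgA b b).
by rewrite mulgg_exp3.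
Qed.

End ExponentThree.

Theorem theorem1 (G : groupType) (exp3 : has_exponent_3 G) : ECP_group G.
Proof.
move=> H Hgr x; have HV a : H a -> H a^-1.
  by move=> Ha; apply/set_mem/(group_closedV Hgr)/mem_set.
have HM a b : H a -> H b -> H (a * b).
  by move=> Ha Hb; apply/set_mem/(group_closedM Hgr); exact: mem_set.
have sub : setprod H (conj_set H x) `<=` setprod (conj_set H x) H.
  move=> _ [a Ha [_ [b Hb <-] <-]].
  (* The identity [a * b ^ x = b ^ (x * a^-1) * a] and [conj_mulV_exp3] dictate both factors. *)
  exists ((b ^ a) ^ x); first by exists (b ^ a) => //; rewrite conjgE; auto.
  exists (b^-1 * b ^ a * a); first by rewrite conjgE; auto 6.
  rewrite mulgA -conjgM -conj_mulV_exp3 // conjgM.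
  by rewrite [(_ ^ x) ^ _]conjgE invgK -!mulgA mulVg mulg1.
apply/seteqP; split=> // _ [_ [b Hb <-] [a Ha <-]].
(* Factor the inverse of [b ^ x * a], then invert back. *)
have [|_ [c Hc <-] [d Hd cdE]] := sub (a^-1 * b^-1 ^ x).
  by exists a^-1; auto; exists (b^-1 ^ x) => //; exists b^-1; auto.
exists d^-1; first exact: HV.
exists (c^-1 ^ x); first by exists c^-1; auto.
by rewrite conjVg -invgM cdE invgM conjVg !invgK.
Qed.
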